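(* Let $\phi\in\mathbb{S}'$ and $A\in M_n(\mathbb{H})$. If $A$ is $\phi$-Hermitian, then $A$ is Hermitian (i.e. $A=A^*$), and there exist a unitary matrix $U\in M_n(\mathbb{C}_{I_\phi})$ and a real diagonal matrix $\Delta$ such that $\Delta=UAU^{*\phi}$.
   Context: $\mathbb{H}$ denotes the real quaternions with units $\boldsymbol{i},\boldsymbol{j},\boldsymbol{k}$, and $M_n(\mathbb{H})$ the $n\times n$ quaternionic matrices. For $Q=(q_{ij})\in M_n(\mathbb{H})$, $Q^*=(\overline{q_{ji}})$ is the conjugate transpose; $U$ is unitary if $UU^*=U^*U=I$. Let $\mathbb{S}^3=\{\phi\in\mathbb{H}:|\phi|=1\}$, $\mathbb{S}=\{\phi\in\mathbb{S}^3:\mathrm{Re}(\phi)=0\}$, and $\mathbb{S}'=\mathbb{S}^3\setminus(\mathbb{S}\cup\{1,-1\})$. For $\phi\in\mathbb{S}^3$ and $A\in M_n(\mathbb{H})$, $A^{*\phi}=\overline{\phi}A^*\phi$ (each entry of $A^*$ is multiplied on the left by $\overline{\phi}$ and on the right by $\phi$). $A$ is called $\phi$-Hermitian if $A=A^{*\phi}$. For $\phi\in\mathbb{H}\setminus\mathbb{R}$ write $\phi=\phi_0+r_\phi I_\phi$ with $\phi_0,r_\phi\in\mathbb{R}$ and $I_\phi$ a unit pure imaginary quaternion (the imaginary unit of $\phi$); $\mathbb{C}_{I_\phi}=\{a+bI_\phi: a,b\in\mathbb{R}\}$, and $M_n(\mathbb{C}_{I_\phi})$ is the set of $n\times n$ quaternionic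 matrices all of whose entries lie in $\mathbb{C}_{I_\phi}$. *)

(* Defs.v *)
From HB Require Import structures.
From mathcomp Require Import all_boot all_order all_algebra ring.
From mathcomp Require Import all_classical all_reals.

Set Implicit Arguments.
Unset Strict Implicit.
Unset Printing Implicit Defensive.

Import Order.TTheory GRing.Theory Num.Theory.

Local Open Scope classical_set_scope.
Local Open Scope ring_scope.

Declare Scope quat_scope.
Delimit Scope quat_scope with H.
Local Open Scope quat_scope.

Record quat (R : Type) : Type :=
  Quat { qre : R; qimi : R; qimj : R; qimk : R }.

Definition tuple_of_quat (R : Type) (q : quat R) : R * R * R * R :=
  (qre q, qimi q, qimj q, qimk q).
Definition quat_of_tuple (R : Type) (t : R * R * R * R) : quat R :=
  let: (a, b, c, d) := t in Quat a b c d.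
Lemma tuple_of_quatK (R : Type) :
  cancel (@tuple_of_quat R) (@quat_of_tuple R).
Proof. by case. Qed.

HB.instance Definition _ (R : eqType) :=
  Equality.copy (quat R) (can_type (@tuple_of_quatK R)).
HB.instance Definition _ (R : choiceType) :=
  Choice.copy (quat R) (can_type (@tuple_of_quatK R)).

Definition qreal (R : nmodType) (a : R) : quat R := Quat a 0 0 0.
Notation "a %:H" := (qreal a) (at level 1, left associativity, format "a %:H")
  : quat_scope.

Definition addq (R : nmodType) (x y : quat R) : quat R :=
  Quat (qre x + qre y) (qimi x + qimi y) (qimj x + qimj y) (qimk x + qimk y).

Definition oppq (R : zmodType) (x : quat R) : quat R :=
  Quat (- qre x) (- qimi x) (- qimj x) (- qimk x).

Definition mulq (R : pzRingType) (x y : quat R) : quat R :=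
  let: Quat a b c d := x in
  let: Quat a' b' c' d' := y in
  Quat (a * a' - b * b' - c * c' - d * d')
       (a * b' + b * a' + c * d' - d * c')
       (a * c' - b * d' + c * a' + d * b')
       (a * d' + b * c' - c * b' + d * a').

Lemma addqA (R : nmodType) : associative (@addq R).
Proof. by move=> x y z; rewrite /addq /= !addrA. Qed.

Lemma addqC (R : nmodType) : commutative (@addq R).
Proof. by move=> x y; congr Quat; apply: addrC. Qed.

Lemma add0q (R : nmodType) : left_id (0 : R)%:H (@addq R).
Proof. by case=> a b c d; rewrite /addq /= !add0r. Qed.

Lemma addNq (R : zmodType) : left_inverse (0 : R)%:H (@oppq R) (@addq R).
Proof. by case=> a b c d; rewrite /addq /= !addNr. Qed.

HB.instance Definition _ (R : zmodType) :=
  GRing.isZmodule.Build (quat R) (@addqA R) (@addqC R) (@add0q R) (@addNq R).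

Lemma mulqA (R : comNzRingType) : associative (@mulq R).
Proof. by case=> ? ? ? ? [? ? ? ?] [? ? ? ?]; congr Quat; ring. Qed.

Lemma mul1q (R : comNzRingType) : left_id (1 : R)%:H (@mulq R).
Proof. by case=> ? ? ? ?; congr Quat; ring. Qed.

Lemma mulq1 (R : comNzRingType) : right_id (1 : R)%:H (@mulq R).
Proof. by case=> ? ? ? ?; congr Quat; ring. Qed.

Lemma mulqDl (R : comNzRingType) : left_distributive (@mulq R) (@addq R).
Proof. by case=> ? ? ? ? [? ? ? ?] [? ? ? ?]; congr Quat => /=; ring. Qed.

Lemma mulqDr (R : comNzRingType) : right_distributive (@mulq R) (@addq R).
Proof. by case=> ? ? ? ? [? ? ? ?] [? ? ? ?]; congr Quat => /=; ring. Qed.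

Lemma oneq_neq0 (R : comNzRingType) : (1 : R)%:H != 0 :> quat R.
Proof. by apply/eqP => -[] /eqP; rewrite oner_eq0. Qed.

HB.instance Definition _ (R : comNzRingType) :=
  GRing.Zmodule_isNzRing.Build (quat R)
    (@mulqA R) (@mul1q R) (@mulq1 R) (@mulqDl R) (@mulqDr R) (@oneq_neq0 R).

Definition qi (R : nzRingType) : quat R := Quat 0 1 0 0.
Definition qj (R : nzRingType) : quat R := Quat 0 0 1 0.
Definition qk (R : nzRingType) : quat R := Quat 0 0 0 1.

Lemma quatE (R : comNzRingType) (q : quat R) :
  q = (qre q)%:H + (qimi q)%:H * qi R + (qimj q)%:H * qj R + (qimk q)%:H * qk R.
Proof. by case: q => a b c d; congr Quat; rewrite /=; ring. Qed.

Lemma hamilton_relations (R : comNzRingType) :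
  [/\ qi R * qi R = - 1, qj R * qj R = - 1, qk R * qk R = - 1
    & qi R * qj R * qk R = - 1].
Proof. by split; congr Quat; rewrite /=; ring. Qed.

Definition qconj (R : zmodType) (q : quat R) : quat R :=
  Quat (qre q) (- qimi q) (- qimj q) (- qimk q).

Definition qim (R : nmodType) (q : quat R) : quat R :=
  Quat 0 (qimi q) (qimj q) (qimk q).

Definition qnorm (R : rcfType) (q : quat R) : R :=
  Num.sqrt (qre q ^+ 2 + qimi q ^+ 2 + qimj q ^+ 2 + qimk q ^+ 2).

Definition S3 (R : rcfType) : set (quat R) := [set q | qnorm q = 1].

Definition pureS (R : rcfType) : set (quat R) := [set q | S3 q /\ qre q = 0].

Definition S' (R : rcfType) : set (quat R) :=
  @S3 R `\` (@pureS R `|` [set 1; - 1]).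

(* The decomposition phi = phi_0 + r_phi I_phi is unique only up to the
   simultaneous change of sign of r_phi and I_phi; we take r_phi >= 0.  The
   plane [slice I] is the same for I and - I.  For real phi the value is the
   junk 0. *)
Definition imunit (R : rcfType) (phi : quat R) : quat R :=
  ((qnorm (qim phi))^-1)%:H * qim phi.

Definition slice (R : comNzRingType) (I : quat R) : set (quat R) :=
  [set q | exists a b : R, q = a%:H + b%:H * I].

Lemma qnorm_qim_eq0 (R : rcfType) (phi : quat R) :
  (qnorm (qim phi) == 0) = (qim phi == 0).
Proof.
rewrite /qnorm /qim /= expr0n add0r sqrtr_eq0.
apply/idP/eqP => [h|[-> -> ->]]; last by rewrite expr0n /= !addr0.
have: qimi phi ^+ 2 + qimj phi ^+ 2 + qimk phi ^+ 2 == 0.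
  by rewrite eq_le h !addr_ge0 ?sqr_ge0.
rewrite !paddr_eq0 ?addr_ge0 ?sqr_ge0 // !sqrf_eq0.
by case/andP=> /andP[/eqP-> /eqP->] /eqP->.
Qed.

Lemma imunit_pureS (R : rcfType) (phi : quat R) :
  qim phi <> 0 -> pureS (imunit phi).
Proof.
move=> /eqP; rewrite -qnorm_qim_eq0 => h; split=> /=; last by ring.
rewrite /S3 /= /imunit; set r := qnorm (qim phi) in h *.
have r2 : r ^+ 2 = qimi phi ^+ 2 + qimj phi ^+ 2 + qimk phi ^+ 2.
  by rewrite sqr_sqrtr /= ?expr0n ?add0r // !addr_ge0 ?sqr_ge0.
rewrite /qnorm /= -[RHS]sqrtr1; congr Num.sqrt.
transitivity (r^-1 ^+ 2 * (qimi phi ^+ 2 + qimj phi ^+ 2 + qimk phi ^+ 2)).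
  by ring.
by rewrite -r2 -exprMn mulVf // expr1n.
Qed.

Lemma imunitE (R : rcfType) (phi : quat R) :
  phi = (qre phi)%:H + (qnorm (qim phi))%:H * imunit phi.
Proof.
have [h|h] := eqVneq (qim phi) 0.
  rewrite /imunit h !mulr0 addr0; case: phi h => a b c d [] /= -> -> -> //.
rewrite /imunit; move: h; rewrite -qnorm_qim_eq0; move: (qnorm _) => r r0.
rewrite mulrA (_ : r%:H * (r^-1)%:H = 1) ?mul1r; last first.
  by congr Quat; rewrite ?mulfV //; ring.
by case: phi => a b c d; congr Quat; rewrite /= ?addr0 ?add0r.
Qed.

Definition ctransmx (R : zmodType) (m n : nat) (A : 'M[quat R]_(m, n)) :
  'M[quat R]_(n, m) := (map_mx (@qconj R) A)^T.

Definition phictransmx (R : comNzRingType) (phi : quat R) (m n : nat)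
    (A : 'M[quat R]_(m, n)) : 'M[quat R]_(n, m) :=
  map_mx (fun q => qconj phi * q * phi) (ctransmx A).

Definition qhermitian (R : zmodType) (n : nat) (A : 'M[quat R]_n) : Prop :=
  A = ctransmx A.

Definition phi_hermitian (R : comNzRingType) (phi : quat R) (n : nat)
    (A : 'M[quat R]_n) : Prop :=
  A = phictransmx phi A.

Definition qunitary (R : comNzRingType) (n : nat) (U : 'M[quat R]_n) : Prop :=
  U *m ctransmx U = 1%:M /\ ctransmx U *m U = 1%:M.

Definition mx_in (T : Type) (S : set T) (m n : nat) (A : 'M[T]_(m, n)) : Prop :=
  forall i j, S (A i j).

(* Main.v *)
From HB Require Import structures.
Require Import Defs.
From mathcomp Require Import all_boot all_order all_algebra ring.
From mathcomp Require Import all_classical all_reals.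
From mathcomp.real_closed Require Import complex.

(** If [A] is [phi]-Hermitian, applying [A = A^{*phi}] twice gives
    [A i j = phi^-2 * A i j * phi^2], so every entry commutes with [phi^2].
    Since [phi^2 = 2 phi_0 phi - |phi|^2] with [phi_0 != 0], every entry
    commutes with [phi] itself ([comm_of_comm_sqr]).  As [phi] is not real, its
    centralizer is the plane of its imaginary unit [I] ([centralizer_slice]), so
    [A] has entries in that plane.  There conjugation by the unit quaternion
    [phi] is trivial: [A^{*phi}] is the ordinary conjugate transpose, and [A]
    is Hermitian ([phictransmx_slice]).

    The plane of [I] is the image of the complex numbers under the injective
    ring morphism [x + i y |-> x + y I], which turns complex conjugation into
    quaternionic conjugation ([slice_inj]).  So [A] is the image of a complex
    Hermitian matrix, and the image of the complex spectral theorem along this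
    morphism is the required diagonalization. *)

Set Implicit Arguments.
Unset Strict Implicit.
Unset Printing Implicit Defensive.

Import Order.TTheory GRing.Theory Num.Theory.

Local Open Scope ring_scope.
Local Open Scope quat_scope.
Local Open Scope sesquilinear_scope.

(** * Conjugation and the norm *)

Lemma qconjM (R : comNzRingType) (p q : quat R) :
  qconj (p * q) = qconj q * qconj p.
Proof. by case: p q => ? ? ? ? [? ? ? ?]; congr Quat => /=; ring. Qed.

Lemma qconjK (R : zmodType) : involutive (@qconj R).
Proof. by case=> a b c d; rewrite /qconj /= !opprK. Qed.

Lemma qnorm_eq1 (R : rcfType) (q : quat R) :
  qnorm q = 1 ->
  qre q ^+ 2 + qimi q ^+ 2 + qimj q ^+ 2 + qimk q ^+ 2 = 1.
Proof.
move=> h; have /sqr_sqrtr :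
  0 <= qre q ^+ 2 + qimi q ^+ 2 + qimj q ^+ 2 + qimk q ^+ 2.
  by rewrite !addr_ge0 ?sqr_ge0.
by rewrite -/(qnorm q) h expr1n.
Qed.

Lemma S3_conjV (R : rcfType) (q : quat R) :
  S3 q -> qconj q * q = 1 /\ q * qconj q = 1.
Proof.
move/qnorm_eq1; case: q => a b c d /= h.
by split; congr Quat => /=; rewrite -?h; ring.
Qed.

Lemma S'_qre_neq0 (R : rcfType) (phi : quat R) : S' phi -> qre phi != 0.
Proof. by case=> h1 h2; apply/eqP => h; apply: h2; left. Qed.

Lemma S'_qim_neq0 (R : rcfType) (phi : quat R) : S' phi -> qim phi <> 0.
Proof.
case=> /qnorm_eq1 + h2 h; case: phi h h2 => a b c d [/= -> -> ->] h2 /eqP.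
rewrite expr0n /= !addr0 sqrf_eq1 => /orP[] /eqP ea; apply: h2; right.
  by left; rewrite ea.
by right; rewrite ea; congr Quat; rewrite oppr0.
Qed.

Lemma phictransmxE (R : comNzRingType) (phi : quat R) m n
    (A : 'M[quat R]_(m, n)) i j :
  phictransmx phi A i j = qconj phi * qconj (A j i) * phi.
Proof. by rewrite !mxE. Qed.

(** * Centralizers *)

(** By [phi^2 = 2 phi_0 phi - |phi|^2], the commutator with [phi^2] is [2 phi_0]
    times the commutator with [phi]. *)
Lemma comm_of_comm_sqr (R : numFieldType) (q phi : quat R) :
  qre phi != 0 -> GRing.comm q (phi * phi) -> GRing.comm q phi.
Proof.
move=> r0 /eqP; rewrite -subr_eq0 => /eqP h; apply/eqP; rewrite -subr_eq0.
have E : q * (phi * phi) - phi * phi * q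
    = (2 * qre phi)%:H * (q * phi - phi * q).
  by clear; case: q phi => ? ? ? ? [? ? ? ?]; congr Quat => /=; ring.
have u : ((2 * qre phi)^-1)%:H * (2 * qre phi)%:H = 1.
  have c0 : 2 * qre phi != 0 by rewrite mulf_neq0 ?pnatr_eq0.
  by congr Quat => /=; rewrite ?mulVf //; ring.
by rewrite -[X in X == _]mul1r -u -mulrA -E h mulr0.
Qed.

(** The commutator of [a + v] and [I] is twice the cross product of [v] and
    [I], so commuting forces [v] to be parallel to [I]. *)
Lemma comm_pureS_slice (R : rcfType) (I q : quat R) :
  pureS I -> GRing.comm q I -> slice I q.
Proof.
case=> /qnorm_eq1; case: I q => o x y z [a b c d] /= + o0.
rewrite o0 expr0n add0r => s [] _ e1 e2 e3.
have half (u : R) : u + u = 0 -> u = 0.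
  by move/eqP; rewrite -mulr2n mulrn_eq0 /= => /eqP.
have f1 : c * z - d * y = 0.
  by apply: half; move/eqP: e1; rewrite -subr_eq0 => /eqP <-; ring.
have f2 : d * x - b * z = 0.
  by apply: half; move/eqP: e2; rewrite -subr_eq0 => /eqP <-; ring.
have f3 : b * y - c * x = 0.
  by apply: half; move/eqP: e3; rewrite -subr_eq0 => /eqP <-; ring.
(* The coefficient of [I] is the inner product of [v] and [I]; since
   [|I| = 1], the identities below are [v = <v, I> I + I x (v x I)] read
   coordinate by coordinate. *)
exists a, (b * x + c * y + d * z); congr Quat => /=.
- by ring.
- apply/eqP; rewrite -subr_eq0; apply/eqP.
  transitivity (b * (1 - (x ^+ 2 + y ^+ 2 + z ^+ 2))
                + y * (b * y - c * x) - z * (d * x - b * z)); first by ring.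
  by rewrite s f3 f2 subrr !mulr0 addr0 subr0.
- apply/eqP; rewrite -subr_eq0; apply/eqP.
  transitivity (c * (1 - (x ^+ 2 + y ^+ 2 + z ^+ 2))
                + z * (c * z - d * y) - x * (b * y - c * x)); first by ring.
  by rewrite s f1 f3 subrr !mulr0 addr0 subr0.
- apply/eqP; rewrite -subr_eq0; apply/eqP.
  transitivity (d * (1 - (x ^+ 2 + y ^+ 2 + z ^+ 2))
                + x * (d * x - b * z) - y * (c * z - d * y)); first by ring.
  by rewrite s f2 f1 subrr !mulr0 addr0 subr0.
Qed.

Lemma qreal_comm (R : comNzRingType) (a : R) (q : quat R) : GRing.comm q a%:H.
Proof. by case: q => ? ? ? ?; congr Quat => /=; ring. Qed.

Lemma comm_imunit (R : rcfType) (q phi : quat R) :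
  GRing.comm q phi -> GRing.comm q (imunit phi).
Proof.
move=> h; apply: commrM; first exact: qreal_comm.
have -> : qim phi = phi - (qre phi)%:H.
  by case: phi {h} => ? ? ? ?; congr Quat => /=; ring.
by apply: commrB => //; exact: qreal_comm.
Qed.

Lemma centralizer_slice (R : rcfType) (q phi : quat R) :
  qim phi <> 0 -> GRing.comm q phi <-> slice (imunit phi) q.
Proof.
move=> h; split=> [c|[a [b ->]]].
  by apply: comm_pureS_slice; [exact: imunit_pureS | exact: comm_imunit].
apply: commr_sym; apply: commrD; first exact: qreal_comm.
apply: commrM; first exact: qreal_comm.
exact: comm_imunit.
Qed.

Lemma slice_conj (R : rcfType) (I q : quat R) :
  pureS I -> slice I q -> slice I (qconj q).
Proof.
case=> _; case: I => o x y z /= o0 [a [b ->]].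
by rewrite o0; exists a, (- b); congr Quat => /=; ring.
Qed.

(** Conjugate transposition keeps the entries in the centralizer of [phi], on
    which [q |-> qconj phi * q * phi] is the identity. *)
Lemma phictransmx_slice (R : rcfType) (phi : quat R) m n
    (A : 'M[quat R]_(m, n)) :
  S3 phi -> qim phi <> 0 -> mx_in (slice (imunit phi)) A ->
  phictransmx phi A = ctransmx A.
Proof.
move=> /S3_conjV[h _] h0 hA; apply/matrixP => i j; rewrite phictransmxE !mxE.
have /(centralizer_slice _ h0) c : slice (imunit phi) (qconj (A j i)).
  exact/slice_conj/hA/imunit_pureS.
by rewrite -mulrA c mulrA h mul1r.
Qed.

(** Expanding [A i j] by the hypothesis and then the resulting [A j i] in the
    same way conjugates [A i j] by [phi^2]. *)
Lemma phi_hermitian_slice (R : rcfType) (phi : quat R) n (A : 'M[quat R]_n) :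
  S' phi -> phi_hermitian phi A -> mx_in (slice (imunit phi)) A.
Proof.
move=> S'phi hA i j; have [S3phi _] := S'phi; have [_ phiV] := S3_conjV S3phi.
apply/(centralizer_slice _ (S'_qim_neq0 S'phi)).
apply: comm_of_comm_sqr (S'_qre_neq0 S'phi) _.
rewrite /GRing.comm; have {2}-> : A i j = qconj phi * qconj phi * A i j * (phi * phi).
  rewrite {1}hA phictransmxE {1}hA phictransmxE !qconjM !qconjK.
  by rewrite !mulrA.
by rewrite !mulrA -(mulrA phi phi) phiV mulr1 phiV mul1r.
Qed.

(** * The plane of an imaginary unit as a copy of the complex numbers *)

(** The proof that [I] is an imaginary unit is an argument so that the ring
    morphism structure can be attached to [slice_inj]. *)
Definition slice_inj (R : rcfType) (I : quat R) of pureS I : R[i] -> quat R :=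
  fun z => (complex.Re z)%:H + (complex.Im z)%:H * I.

Lemma pureS_sqr (R : rcfType) (I : quat R) : pureS I -> I * I = - 1.
Proof.
case=> /qnorm_eq1; case: I => o x y z /= + o0; rewrite o0 expr0n add0r => s.
by congr Quat => /=; rewrite -?s; ring.
Qed.

Lemma slice_inj_is_zmod_morphism (R : rcfType) (I : quat R) (hI : pureS I) :
  zmod_morphism (slice_inj hI).
Proof.
move=> [a b] [c d]; rewrite /slice_inj /=; clear hI.
by case: I => o x y z; congr Quat => /=; ring.
Qed.

Lemma slice_inj_is_monoid_morphism (R : rcfType) (I : quat R) (hI : pureS I) :
  monoid_morphism (slice_inj hI).
Proof.
split=> [|[a b] [c d]]; rewrite /slice_inj /=.
  by clear hI; case: I => o x y z; congr Quat => /=; ring.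
have E : (a%:H + b%:H * I) * (c%:H + d%:H * I)
    = (a * c)%:H + (a * d + b * c)%:H * I + (b * d)%:H * (I * I).
  by clear hI; case: I => o x y z; congr Quat => /=; ring.
rewrite E pureS_sqr //; clear hI E.
by case: I => o x y z; congr Quat => /=; ring.
Qed.

HB.instance Definition _ (R : rcfType) (I : quat R) (hI : pureS I) :=
  GRing.isZmodMorphism.Build R[i] (quat R) (slice_inj hI)
    (slice_inj_is_zmod_morphism hI).
HB.instance Definition _ (R : rcfType) (I : quat R) (hI : pureS I) :=
  GRing.isMonoidMorphism.Build R[i] (quat R) (slice_inj hI)
    (slice_inj_is_monoid_morphism hI).

Lemma slice_inj_conj (R : rcfType) (I : quat R) (hI : pureS I) (z : R[i]) :
  slice_inj hI (Num.conj z) = qconj (slice_inj hI z).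
Proof.
case: z => a b; rewrite /slice_inj /=.
by case: I hI => o x y z [_ /= ->]; congr Quat => /=; ring.
Qed.

Lemma slice_inj_real (R : rcfType) (I : quat R) (hI : pureS I) (z : R[i]) :
  z \is Num.real -> range (@qreal R) (slice_inj hI z).
Proof.
move/complex_realP => [x ->]; exists x => //.
by rewrite /slice_inj /=; clear; case: I => *; congr Quat => /=; ring.
Qed.

Lemma ctransmx_slice_inj (R : rcfType) (I : quat R) (hI : pureS I) m n
    (B : 'M[R[i]]_(m, n)) :
  ctransmx (map_mx (slice_inj hI) B) = map_mx (slice_inj hI) (B ^t*).
Proof. by apply/matrixP => i j; rewrite !mxE slice_inj_conj. Qed.

Lemma mx_in_slice_inj (R : rcfType) (I : quat R) (hI : pureS I) m n
    (B : 'M[R[i]]_(m, n)) :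
  mx_in (slice I) (map_mx (slice_inj hI) B).
Proof. by move=> i j; rewrite mxE; do 2!eexists. Qed.

Lemma mx_in_sliceP (R : rcfType) (I : quat R) (hI : pureS I) m n
    (A : 'M[quat R]_(m, n)) :
  mx_in (slice I) A -> exists B, A = map_mx (slice_inj hI) B.
Proof.
move=> hA; have hz i j : exists z, A i j = slice_inj hI z.
  by have [a [b ->]] := hA i j; exists (Complex a b).
exists (\matrix_(i, j) projT1 (cid (hz i j))).
by apply/matrixP => i j; rewrite !mxE; case: (cid _).
Qed.

(** * Diagonalization *)

(** The complex unitary [P] with [B = P^-1 D P] is transported along
    [slice_inj]; the eigenvalues of a Hermitian matrix being real, their images
    are real quaternions. *)
Lemma hermitian_slice_spectral (R : rcfType) (I : quat R) n
    (A : 'M[quat R]_n) :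
  pureS I -> mx_in (slice I) A -> qhermitian A ->
  exists U Delta : 'M[quat R]_n,
    [/\ qunitary U, mx_in (slice I) U,
        is_diag_mx Delta, mx_in (range (@qreal R)) Delta
      & Delta = U *m A *m ctransmx U].
Proof.
move=> hI /(mx_in_sliceP hI)[B ->]; rewrite /qhermitian ctransmx_slice_inj.
move=> /matrixP hAB; have {hAB} hB : B = B ^t*.
  by apply/matrixP => i j; have := hAB i j; rewrite !mxE => /fmorph_inj.
have Bherm : B \is hermsymmx.
  by apply/is_hermitianmxP; rewrite expr0 scale1r.
set f := slice_inj hI; set P := spectralmx B.
have Puni : P \is unitarymx := spectral_unitarymx B.
have PPt : P *m P ^t* = 1%:M by exact/unitarymxP.
have PtP : P ^t* *m P = 1%:M by exact: mulmx1C.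
exists (map_mx f P), (map_mx f (diag_mx (spectral_diag B))); split.
- by rewrite /qunitary ctransmx_slice_inj -!map_mxM PPt PtP map_mx1.
- exact: mx_in_slice_inj.
- by rewrite map_diag_mx diag_mx_is_diag.
- move=> i j; rewrite mxE; apply: slice_inj_real; rewrite mxE.
  have /mxOverP := hermitian_spectral_diag_real Bherm.
  by case: (i == j) => [/(_ 0 i)|_]; rewrite ?mulr1n ?mulr0n ?real0.
- rewrite ctransmx_slice_inj -!map_mxM; congr map_mx.
  have /orthomx_spectralP BE := hermitian_normalmx Bherm.
  rewrite [X in P *m X]BE -/P invmx_unitary //.
  by rewrite !mulmxA PPt mul1mx -mulmxA PPt mulmx1.
Qed.

Theorem theorem3p14 (R : realType) (phi : quat R) (n : nat) (A : 'M[quat R]_n) :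
  S' phi -> phi_hermitian phi A ->
  qhermitian A /\
  exists U Delta : 'M[quat R]_n,
    [/\ qunitary U, mx_in (slice (imunit phi)) U,
        is_diag_mx Delta, mx_in (range (@qreal R)) Delta
      & Delta = U *m A *m phictransmx phi U].
Proof.
move=> S'phi hA; have [S3phi _] := S'phi; have im0 := S'_qim_neq0 S'phi.
have Aslice := phi_hermitian_slice S'phi hA.
have Aherm : qhermitian A by rewrite /qhermitian -(phictransmx_slice S3phi im0).
split=> //.
have [U [D [Uuni Uslice Ddiag Dreal DE]]] :=
  hermitian_slice_spectral (imunit_pureS im0) Aslice Aherm.
by exists U, D; split=> //; rewrite phictransmx_slice.
Qed.
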